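(* Let $(X,T)$ be a topological space and $\Phi\subseteq C(X,\mathbb R)$. Then the nonstandard $\Phi$-hull $(\widehat X_\Phi,\widehat T)$ of $(X,T)$ is a Hausdorff space.
   Context: Nonstandard setting. Let $S\supseteq X\cup\mathbb R$ be a set of individuals, with superstructure $V(S)=\bigcup_{k\ge 0}V_k(S)$, $V_0(S)=S$, $V_{k+1}(S)=V_k(S)\cup\mathcal P(V_k(S))$. A $\kappa$-saturated nonstandard model of $S$ is a superstructure $V({}^*S)$ with a map $A\mapsto {}^*A$ from $V(S)$ into $V({}^*S)$ satisfying: (Extension) ${}^*s=s$ for all $s\in S$; (Transfer) a bounded quantifier formula $\Psi(A_1,\dots,A_n)$ with constants in $V(S)$ is true iff $\Psi({}^*A_1,\dots,{}^*A_n)$ is true in $V({}^*S)$; (Saturation) every family of at most $\kappa$ internal sets with the finite intersection property has nonempty intersection. An entity of $V({}^*S)$ is internal if it is an element of ${}^*A$ for some $A\in V(S)$. Throughout, a $\kappa$-saturated model with $\kappa$ infinite and $\kappa>\operatorname{card}T$ is fixed; $X\subseteq {}^*X$. The standard topology ${}^sT$ on ${}^*X$ has base $\{{}^*G:G\in T\}$. $C(X,\mathbb R)$ is the set of continuous real-valued functions on $(X,T)$ ($\mathbb R$ with the usual topology). In ${}^*\mathbb R$: $\xi$ is finite if $|\xi|<n$ for some $n\in\mathbb N$; $\xi\approx\eta$ if $|\xi-\eta|<1/n$ for all $n\in\mathbb N$. For $\Phi\subseteq C(X,\mathbb R)$: $\widetilde X_\Phi=\{\alpha\in{}^*X: {}^*f(\alpha)\text{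 is finite for all } f\in\Phi\}$ with the subspace topology from $({}^*X,{}^sT)$; for $\alpha,\beta\in\widetilde X_\Phi$, $\alpha\sim_\Phi\beta$ iff ${}^*f(\alpha)\approx{}^*f(\beta)$ for all $f\in\Phi$; $\widehat X_\Phi=\widetilde X_\Phi/\!\sim_\Phi$ with the quotient topology $\widehat T$. The space $(\widehat X_\Phi,\widehat T)$ is the nonstandard $\Phi$-hull of $(X,T)$. *)

(* Defs.v *)
From Stdlib Require Import Eqdep_dec.
From HB Require Import structures.
From mathcomp Require Import all_boot all_order all_algebra generic_quotient.
From mathcomp Require Import all_classical all_reals all_analysis.

Set Implicit Arguments.
Unset Strict Implicit.
Unset Printing Implicit Defensive.

Import Order.TTheory GRing.Theory Num.Theory.
Import numFieldNormedType.Exports.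

Local Open Scope classical_set_scope.
Local Open Scope card_scope.
Local Open Scope ring_scope.

Section level.
Variables (S E : Type) (ind : S -> E) (vset : set E -> E).

Fixpoint level (k : nat) : set E :=
  if k is k'.+1 then level k' `|` [set vset P | P in [set P | P `<=` level k']]
  else range ind.

End level.

(* V(S), up to isomorphism: [ind] injects the individuals, and [vset] sends a
   subset of some V_k(S) to the entity of V_{k+1}(S) with these members. The
   value of [vset] on other sets is irrelevant. Extensionality holds because
   every entity is [ind s] or [vset P] for some P contained in some V_k(S). *)
Record superstructure (S : Type) := Superstructure {
  entity :> Type;
  ind : S -> entity;
  vmem : entity -> entity -> Prop;
  vset : set entity -> entity;
  ind_inj : injective ind;
  memN_ind : forall x s, ~ vmem x (ind s);
  vset_neq_ind : forall k (P : set entity) s,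
    P `<=` level ind vset k -> vset P <> ind s;
  mem_vset : forall k (P : set entity) x,
    P `<=` level ind vset k -> vmem x (vset P) <-> P x;
  level_exhaust : forall x, exists k, level ind vset k x }.

Arguments ind {S _}.
Arguments vmem {S _}.
Arguments vset {S _}.

Module SuperstructureExists.
Section construction.
Variable S : Type.

(* V_{k+1} adds to V_k exactly the subsets of V_k that are not yet entities, so
   V(S) is S plus the sum over k of the types of these new subsets. *)
Record stage := Stage {
  st :> Type; st_set : st -> Prop; st_mem : st -> st -> Prop }.

Definition new_set (E : stage) :=
  {P : set E | ~ exists A, st_set A /\ P = [set x | st_mem x A]}.

Definition next_stage (E : stage) : stage := @Stage (E + new_set E)
  (fun A => if A is inl A' then st_set A' else True)
  (fun x A => match x, A with
     | inl x', inl A' => st_mem x' A'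
     | inl x', inr P => sval P x'
     | inr _, _ => False end).

Fixpoint stg (k : nat) : stage :=
  if k is k'.+1 then next_stage (stg k')
  else @Stage S (fun=> False) (fun _ _ => False).

Definition car : Type := S + {k : nat & new_set (stg k)}.

Fixpoint emb k : stg k -> car :=
  match k return stg k -> car with
  | 0 => fun s => inl s
  | k'.+1 => fun x => match x with
      | inl x' => emb x'
      | inr P => inr (existT (fun k => new_set (stg k)) k' P) end
  end.

Definition cset (x : car) : Prop := if x is inr _ then True else False.
Definition cmem (y x : car) : Prop :=
  if x is inr (existT k P) then exists2 z, sval P z & emb z = y else False.

Definition crank (x : car) : nat := if x is inr (existT k _) then k.+1 else 0.

Lemma crank_emb k (x : stg k) : (crank (emb x) <= k)%N.
Proof. by elim: k x => [//|k IH] [x|P] /=; first exact: leqW. Qed.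

Lemma emb_inj k : injective (@emb k).
Proof.
elim: k => [|k IH]; first by move=> x y [].
case=> [x|P] [y|Q] /=.
- by move/IH->.
- by move=> h; have := crank_emb x; rewrite h /= ltnn.
- by move=> h; have := crank_emb y; rewrite -h /= ltnn.
- move=> h; have {}h : existT (fun k => new_set (stg k)) k P = existT _ k Q.
    exact: (congr1 (fun z => if z is inr w then w else existT _ k P) h).
  by rewrite (inj_pair2_eq_dec _ (@eq_comparable nat) _ _ _ _ h).
Qed.

Lemma cset_emb k (x : stg k) : cset (emb x) <-> st_set x.
Proof. by elim: k x => [//|k IH] [x|P] //=. Qed.

Lemma cmem_emb k (A : stg k) y :
  cmem y (emb A) <-> exists2 x, st_mem x A & emb x = y.
Proof.
elim: k A => [A|k IH [A|P]] /=; first by split=> // -[].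
- rewrite -/(cmem y (emb A)); split.
    by case/IH => x xA xy; exists (inl x).
  by case=> -[x|//] xA xy; apply/IH; exists x.
- split; first by case=> x Px <-; exists (inl x).
  by case=> -[x|//] Px <-; exists x.
Qed.

Lemma emb_range k j (x : stg k) : (k <= j)%N -> exists y : stg j, emb y = emb x.
Proof.
elim: j x => [|j IH] x; first by case: k x => // x _; exists x.
rewrite leq_eqVlt => /orP[/eqP kj|]; first by case: _ / kj; exists x.
by rewrite ltnS => /(IH x)[y <-]; exists (inl y).
Qed.

Lemma emb_car (x : car) : exists y : stg (crank x), emb y = x.
Proof. by case: x => [s|[k P]] /=; [exists s|exists (inr P)]. Qed.

Lemma stg_ext k (A B : stg k) : st_set A -> st_set B ->
  (forall x, st_mem x A <-> st_mem x B) -> A = B.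
Proof.
elim: k A B => [//|k IH] [A|[P nP]] [B|[Q nQ]] /= sA sB AB.
- by congr inl; apply: IH => // x; exact: (AB (inl x)).
- case: nQ; exists A; split=> //; apply/funext => x; apply/propext.
  by have /= := AB (inl x); tauto.
- case: nP; exists B; split=> //; apply/funext => x; apply/propext.
  by have /= := AB (inl x); tauto.
- congr inr; apply: eq_exist; apply/funext => x; apply/propext.
  exact: (AB (inl x)).
Qed.

Lemma car_ext (x y : car) : cset x -> cset y ->
  (forall z, cmem z x <-> cmem z y) -> x = y.
Proof.
move=> cx cy xy; have [k [a ax] [b bY]] :
    exists2 k, exists a : stg k, emb a = x & exists b : stg k, emb b = y.
  have [a ax] := emb_car x; have [b bY] := emb_car y.
  exists (maxn (crank x) (crank y)).
    by have [a' a'E] := emb_range a (leq_maxl _ (crank y)); exists a'; rewrite a'E.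
  by have [b' b'E] := emb_range b (leq_maxr (crank x) _); exists b'; rewrite b'E.
rewrite -ax -bY in cx cy xy *.
congr emb; apply: stg_ext; try exact/cset_emb.
move=> z; have := xy (emb z); rewrite !cmem_emb => -[h1 h2].
split=> hz; [case: h1|case: h2]; try by exists z.
  by move=> z' ? /emb_inj <-.
by move=> z' ? /emb_inj <-.
Qed.

Definition cempty : car.
Proof. by right; exists 0%N; exists set0 => -[A []]. Defined.

Definition cvset (P : set car) : car :=
  if pselect (exists v, cset v /\ forall y, cmem y v <-> P y) is left h
  then projT1 (cid h) else cempty.

Lemma cvsetP k (P : set car) : P `<=` range (@emb k) ->
  cset (cvset P) /\ forall y, cmem y (cvset P) <-> P y.
Proof.
move=> Pk; rewrite /cvset; case: pselect => [h|[]]; first by case: (cid h).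
have PE y : (exists2 z, P (@emb k z) & emb z = y) <-> P y.
  split=> [[z Pz <-]//|Py]; have [z _ zy] := Pk _ Py.
  by exists z => //; rewrite zy.
have [[A [sA AE]]|nP] :=
  pselect (exists A : stg k, st_set A /\ @emb k @^-1` P = [set x | st_mem x A]).
  exists (emb A); split; first exact/cset_emb.
  move=> y; rewrite cmem_emb -PE; split=> -[z zA zy]; exists z => //.
    by have : (@emb k @^-1` P) z by rewrite AE.
  by have : (@emb k @^-1` P) z by []; rewrite AE.
exists (inr (existT _ k (exist _ (@emb k @^-1` P) nP))).
by split=> // y; rewrite -PE.
Qed.

Lemma level_car k : level inl cvset k = range (@emb k).
Proof.
elim: k => [|k IH] /=; first by [].
rewrite IH; apply/seteqP; split=> [x [[y _ <-]|[P Pk <-]]|x [[y|P] _ <-]] /=.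
- by exists (inl y).
- have [cP PE] := cvsetP Pk.
  have [[A [sA AE]]|nP] :=
    pselect (exists A : stg k, st_set A /\ @emb k @^-1` P = [set x | st_mem x A]).
    have AEz z : P (emb z) = st_mem z A := congr1 (@^~ z) AE.
    exists (inl A) => //; apply: car_ext => //; first exact/cset_emb.
    move=> y; rewrite PE cmem_emb; split=> [[z zA <-]|Py]; first by rewrite AEz.
    by have [z _ zy] := Pk _ Py; exists z => //; rewrite -AEz zy.
  exists (inr (exist _ (@emb k @^-1` P) nP)) => //; apply: car_ext => // y /=.
  rewrite PE; split=> [[z ? <-]//|Py]; have [z _ zy] := Pk _ Py.
  by exists z => //; rewrite zy.
- by left; exists y.
- right; exists (@emb k @` sval P); first by move=> y /= [z _ <-]; exists z.
  have Pk : @emb k @` sval P `<=` range (@emb k) by move=> _ [z _ <-]; exists z.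
  have [cP PE] := cvsetP Pk.
  by apply: car_ext => // y; rewrite PE.
Qed.

Definition witness : superstructure S.
Proof.
apply: (@Superstructure S car inl cmem cvset).
- by move=> x y [].
- by move=> x s [].
- by move=> k P s Pk h; rewrite level_car in Pk; have [] := cvsetP Pk; rewrite h.
- by move=> k P x Pk; rewrite level_car in Pk; have [] := cvsetP Pk.
- by move=> x; exists (crank x); rewrite level_car; have [y yx] := emb_car x; exists y.
Defined.

End construction.
End SuperstructureExists.

(* Bounded quantifier formulas over equality and membership. Variables are
   natural numbers; [BAll i j p] is "for all v_i in v_j, p". The values of the
   free variables play the role of the constants. *)
Inductive bformula : Type :=
  | BEq of nat & nat
  | BMem of nat & nat
  | BNot of bformula
  | BAnd of bformula & bformula
  | BOr of bformula & bformula
  | BImp of bformula & bformula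
  | BAll of nat & nat & bformula
  | BEx of nat & nat & bformula.

Definition upd (E : Type) (rho : nat -> E) (i : nat) (v : E) : nat -> E :=
  fun j => if j == i then v else rho j.

Fixpoint sat (S : Type) (V : superstructure S) (rho : nat -> V)
    (phi : bformula) : Prop :=
  match phi with
  | BEq i j => rho i = rho j
  | BMem i j => vmem (rho i) (rho j)
  | BNot p => ~ sat rho p
  | BAnd p q => sat rho p /\ sat rho q
  | BOr p q => sat rho p \/ sat rho q
  | BImp p q => sat rho p -> sat rho q
  | BAll i j p => forall x, vmem x (rho j) -> sat (upd rho i x) p
  | BEx i j p => exists2 x, vmem x (rho j) & sat (upd rho i x) p
  end.

Definition internal (S sS : Type) (V : superstructure S)
    (sV : superstructure sS) (star : V -> sV) : set sV :=
  [set x | exists A, vmem x (star A)].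

(* [sS] is the set of individuals of the nonstandard universe [sV], and
   [star_individuals] says that it is the image of S; [incl] is the inclusion
   of S in it. [K] is a type of cardinality kappa. *)
Record nonstandard_model (K S sS : Type)
    (V : superstructure S) (sV : superstructure sS) := NonstandardModel {
  star :> V -> sV;
  incl : S -> sS;
  star_individuals : star (vset (range ind)) = vset (range ind);
  star_extension : forall s, star (ind s) = ind (incl s);
  star_transfer : forall phi (rho : nat -> V),
    sat rho phi <-> sat (star \o rho) phi;
  star_saturation : forall F : set sV,
    F `<=` internal star -> F #<= [set: K] ->
    (forall G, G `<=` F -> finite_set G -> exists x, forall A, G A -> vmem x A) ->
    exists x, forall A, F A -> vmem x A }.

(* A set of individuals containing copies of X and R, which may overlap. *)
Record individuals (X R : Type) := Individuals {
  individual :> Type;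
  of_point : X -> individual;
  of_real : R -> individual;
  of_point_inj : injective of_point;
  of_real_inj : injective of_real }.

Section coding.
Variables (S : Type) (V : superstructure S).

(* Kuratowski pairs, so that relations and functions are entities. *)
Definition vpair (a b : V) : V := vset [set vset [set a]; vset [set a; b]].

Definition vgraph (A B : Type) (a : A -> V) (b : B -> V) (f : A -> B) : V :=
  vset (range (fun x => vpair (a x) (b (f x)))).

Definition vrel (A B : Type) (a : A -> V) (b : B -> V) (r : A -> B -> Prop)
    : V := vset [set vpair (a p.1) (b p.2) | p in [set p | r p.1 p.2]].

(* The value at [x] of the function with graph [F]; junk outside its domain. *)
Definition vapp (F x : V) : V :=
  if pselect (exists y, vmem (vpair x y) F) is left h then projT1 (cid h) else F.

End coding.

Definition card_lt (T U : Type) (A : set T) (B : set U) : Prop :=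
  A #<= B /\ ~ (B #<= A).

Section entity_theory.
Variables (S : Type) (V : superstructure S).
Implicit Types (a b x y z : V) (P : set V).

Definition vbounded P := exists k, P `<=` level ind vset k.

Lemma mem_vsetb P x : vbounded P -> vmem x (vset P) <-> P x.
Proof. by case=> k; exact: mem_vset. Qed.

Lemma levelD j k : level (@ind S V) vset k `<=` level ind vset (k + j).
Proof. by elim: j => [|j IH] x h; rewrite ?addn0// addnS; left; exact: IH. Qed.

Lemma boundedU P Q : vbounded P -> vbounded Q -> vbounded (P `|` Q).
Proof.
case=> j Pj [k Qk]; exists (j + k)%N => x [/Pj|/Qk]; first exact: levelD.
by rewrite addnC; exact: levelD.
Qed.

Lemma bounded1 x : vbounded [set x].
Proof. by have [k xk] := level_exhaust x; exists k => _ ->. Qed.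

Lemma bounded2 x y : vbounded [set x; y].
Proof. exact: boundedU (bounded1 x) (bounded1 y). Qed.

Lemma level_vset k P : P `<=` level ind vset k -> level ind vset k.+1 (vset P).
Proof. by move=> Pk; right; exists P. Qed.

Lemma level_pair k x y : level ind vset k x -> level ind vset k y ->
  level ind vset k.+2 (vpair x y).
Proof.
by move=> xk yk; apply: level_vset => _ [->|->]; apply: level_vset => _ // [] ->.
Qed.

Lemma level_ind k s : level ind vset k (ind s : V).
Proof. by rewrite -(add0n k); apply: levelD; exists s. Qed.

Lemma bounded_ind (A : set S) : vbounded ((ind : S -> V) @` A).
Proof. by exists 0%N => _ [s _ <-]; exists s. Qed.

Lemma entityP x : (exists s, x = ind s) \/ exists2 P, vbounded P & x = vset P.
Proof.
have [k] := level_exhaust x; elim: k => [[s _ <-]|k IH [//|[P Pk <-]]].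
  by left; exists s.
by right; exists P => //; exists k.
Qed.

Lemma entity_ext z x y :
  vmem z x -> (forall t, vmem t x <-> vmem t y) -> x = y.
Proof.
move=> zx xy; have zy : vmem z y by apply/xy.
case: (entityP x) => [[s xs]|[P bP xP]]; first by case: (@memN_ind _ _ z s); rewrite -xs.
case: (entityP y) => [[s ys]|[Q bQ yQ]]; first by case: (@memN_ind _ _ z s); rewrite -ys.
rewrite xP yQ in xy *.
by congr vset; apply/funext => t; apply/propext; have := xy t; rewrite !mem_vsetb.
Qed.

Lemma mem1 x a : vmem x (vset [set a]) <-> x = a.
Proof. by rewrite mem_vsetb//; exact: bounded1. Qed.

Lemma mem2 x a b : vmem x (vset [set a; b]) <-> x = a \/ x = b.
Proof. by rewrite mem_vsetb//; exact: bounded2. Qed.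

Lemma vset2_inj x y a b : vset [set x; y] = vset [set a; b] :> V ->
  (x = a \/ x = b) /\ (y = a \/ y = b) /\ (a = x \/ a = y) /\ (b = x \/ b = y).
Proof.
move=> h; have H t : (t = x \/ t = y) <-> (t = a \/ t = b) by rewrite -!mem2 h.
split; first by apply/H; left.
split; first by apply/H; right.
by split; apply/H; [left|right].
Qed.

Lemma vpair_inj x y a b : vpair x y = vpair a b -> x = a /\ y = b.
Proof.
move/vset2_inj => -[h1 [h2 [_ h4]]].
have xa : a = x.
  have : vmem a (vset [set x]) by case: h1 => ->; [apply/mem1|apply/mem2; left].
  by move/mem1.
subst a.
have yb : y = x \/ y = b.
  have : vmem y (vset [set x; y]) by apply/mem2; right.
  by case: h2 => -> => [/mem1|/mem2]; [left|].
have bY : b = x \/ b = y.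
  have : vmem b (vset [set x; b]) by apply/mem2; right.
  by case: h4 => -> => [/mem1|/mem2]; [left|].
split=> //; case: yb => [yx|//]; case: bY => [bx|//].
by rewrite yx bx.
Qed.

(* v_u = {v_x}, v_u = {v_x, v_y} and v_p = (v_x, v_y), with 100 and 101 reserved
   for bound variables. *)
Definition fsing (u x : nat) := BAnd (BMem x u) (BAll 101 u (BEq 101 x)).
Definition fdoub (u x y : nat) := BAnd (BAnd (BMem x u) (BMem y u))
  (BAll 101 u (BOr (BEq 101 x) (BEq 101 y))).
Definition fpair (p x y : nat) := BAnd
  (BAnd (BEx 100 p (fsing 100 x)) (BEx 100 p (fdoub 100 x y)))
  (BAll 100 p (BOr (fsing 100 x) (fdoub 100 x y))).

Lemma updE (rho : nat -> V) i v : upd rho i v i = v.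
Proof. by rewrite /upd eqxx. Qed.

Lemma updN (rho : nat -> V) i j v : (j < i)%N -> upd rho i v j = rho j.
Proof. by rewrite /upd ltn_neqAle => /andP[/negPf->]. Qed.

Lemma sat_sing (rho : nat -> V) (u x : nat) : (u < 101)%N -> (x < 101)%N ->
  sat rho (fsing u x) <-> rho u = vset [set rho x].
Proof.
move=> lu lx /=; split=> [[xu H]|->]; last first.
  split=> [|w /mem1]; first exact/mem1.
  by rewrite updE updN.
apply: (entity_ext xu) => t; rewrite mem1; split=> [/H|->//].
by rewrite updE updN.
Qed.

Lemma sat_doub (rho : nat -> V) (u x y : nat) :
  (u < 101)%N -> (x < 101)%N -> (y < 101)%N ->
  sat rho (fdoub u x y) <-> rho u = vset [set rho x; rho y].
Proof.
move=> lu lx ly /=; split=> [[[xu yu] H]|->]; last first.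
  split=> [|w /mem2]; last by rewrite updE !updN.
  by split; apply/mem2; [left|right].
apply: (entity_ext xu) => t; rewrite mem2; split=> [/H|[->|->]//].
by rewrite updE !updN.
Qed.

Lemma sat_pair (rho : nat -> V) (p x y : nat) :
  (p < 100)%N -> (x < 100)%N -> (y < 100)%N ->
  sat rho (fpair p x y) <-> rho p = vpair (rho x) (rho y).
Proof.
move=> lp lx ly.
have S1 v : sat (upd rho 100 v) (fsing 100 x) <-> v = vset [set rho x].
  by rewrite sat_sing// ?updE ?updN// ltnW.
have S2 v : sat (upd rho 100 v) (fdoub 100 x y) <-> v = vset [set rho x; rho y].
  by rewrite sat_doub// ?updE ?updN// ltnW.
split=> [[[[u up /S1 uE] [v vp /S2 vE]] H]|pE].
  apply: (entity_ext up) => t; rewrite mem2; split=> [/H|[->|->]].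
  - by case=> [/S1|/S2] ->; [left|right].
  - by rewrite -uE.
  - by rewrite -vE.
split; first split.
- by exists (vset [set rho x]); [rewrite pE mem2; left|exact/S1].
- by exists (vset [set rho x; rho y]); [rewrite pE mem2; right|exact/S2].
- move=> t; rewrite pE => /mem2[] tE; [left; exact/S1|right; exact/S2].
Qed.

Lemma vappP F x : (exists y, vmem (vpair x y) F) -> vmem (vpair x (vapp F x)) F.
Proof. by move=> h; rewrite /vapp; case: pselect => // h'; case: (cid h'). Qed.

End entity_theory.

Arguments fpair : simpl never.
Arguments vpair : simpl never.

Section model_theory.
Variables (K S sS : Type) (V : superstructure S) (sV : superstructure sS).
Variable M : nonstandard_model K V sV.

Lemma star_subset (A B : V) : (forall x, vmem x A -> vmem x B) ->
  forall x, vmem x (M A) -> vmem x (M B).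
Proof.
move=> AB; apply: (proj1 (star_transfer M (BAll 2 0 (BMem 2 1))
  (nth A [:: A; B]))).
exact: AB.
Qed.

Lemma star_and (A B C : V) : (forall x, vmem x A -> vmem x B -> vmem x C) ->
  forall x, vmem x (M A) -> vmem x (M B) -> vmem x (M C).
Proof.
move=> AB; apply: (proj1 (star_transfer M
  (BAll 3 0 (BImp (BMem 3 1) (BMem 3 2))) (nth A [:: A; B; C]))).
exact: AB.
Qed.

(* F is (the graph of) a function from A to B. *)
Record vfunctional (T : Type) (W : superstructure T) (A B F : W) : Prop := {
  fun_tot : forall x, vmem x A -> exists2 y, vmem y B & vmem (vpair x y) F;
  fun_dom : forall x y, vmem (vpair x y) F -> vmem x A /\ vmem y B;
  fun_uniq : forall x y z, vmem (vpair x y) F -> vmem (vpair x z) F -> y = z }.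

Lemma star_functional (A B F : V) : (forall p, vmem p F -> exists x y, p = vpair x y) ->
  vfunctional A B F -> vfunctional (M A) (M B) (M F).
Proof.
move=> Fp [tot dom uniq]; pose rho := nth A [:: A; B; F].
have tot' := proj1 (star_transfer M
  (BAll 3 0 (BEx 4 1 (BEx 5 2 (fpair 5 3 4)))) rho).
have dom' := proj1 (star_transfer M
  (BAll 5 2 (BEx 3 0 (BEx 4 1 (fpair 5 3 4)))) rho).
have uniq' := proj1 (star_transfer M
  (BAll 3 0 (BAll 4 1 (BAll 5 2 (BAll 6 1 (BAll 7 2
   (BImp (fpair 5 3 4) (BImp (fpair 7 3 6) (BEq 4 6)))))))) rho).
have D x y : vmem (vpair x y) (M F) -> vmem x (M A) /\ vmem y (M B).
  move=> /(dom' _)[|x' xA [y' yB]].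
    move=> p /= pF; have [x1 [y1 pE]] := Fp _ pF; subst p.
    have [xA yB] := dom _ _ pF; exists x1 => //; exists y1 => //.
    exact/sat_pair.
  by move/sat_pair => /(_ erefl erefl erefl) /vpair_inj[-> ->].
split=> //.
- move=> x /(tot' _)[|y yB [p pF]].
    move=> x' x'A; have [y yB yF] := tot _ x'A.
    by exists y => //; exists (vpair x' y) => //; apply/sat_pair.
  by move/sat_pair => /(_ erefl erefl erefl) pE; exists y => //; rewrite -pE.
- move=> x y z xyF xzF; have [xA yB] := D _ _ xyF; have [_ zB] := D _ _ xzF.
  apply: (uniq' _ x xA y yB _ xyF z zB _ xzF); try exact/sat_pair.
  move=> x1 ? y1 ? p pF z1 ? q qF /sat_pair pE /sat_pair qE.
  apply: (uniq x1 y1 z1).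
    by rewrite -pE.
  by rewrite -qE.
Qed.

Lemma functional_app (T : Type) (W : superstructure T) (A B F x : W) :
  vfunctional A B F -> vmem x A ->
  vmem (vapp F x) B /\ forall y, vmem (vpair x y) F <-> y = vapp F x.
Proof.
move=> [tot dom uniq] xA; have [y yB xyF] := tot _ xA.
have xF : vmem (vpair x (vapp F x)) F by apply: vappP; exists y.
split; first by case: (dom _ _ xF).
by move=> z; split=> [xzF|->//]; apply: uniq xzF xF.
Qed.

Section graph.
Variables (A B : Type) (a : A -> V) (b : B -> V) (f : A -> B).
Hypotheses (a_inj : injective a) (ba : vbounded (range a)) (bb : vbounded (range b)).

Lemma bounded_pairs (P : set V) :
  (forall p, P p -> exists x y, p = vpair (a x) (b y)) -> vbounded P.
Proof.
move=> PE; have [k ak] := boundedU ba bb; exists k.+2 => p /PE [x [y ->]].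
by apply: level_pair; apply: ak; [left|right]; [exists x|exists y].
Qed.

Lemma mem_graph p : vmem p (vgraph a b f) <-> exists x, p = vpair (a x) (b (f x)).
Proof.
rewrite mem_vsetb; last by apply: bounded_pairs => _ [x _ <-]; exists x, (f x).
by split=> [[x _ <-]|[x ->]]; exists x.
Qed.

Lemma graph_functional :
  vfunctional (vset (range a)) (vset (range b)) (vgraph a b f).
Proof.
split.
- move=> x /mem_vsetb[//|x' _ <-]; exists (b (f x')).
    by apply/mem_vsetb => //; exists (f x').
  by apply/mem_graph; exists x'.
- move=> x y /mem_graph[x' /vpair_inj[-> ->]].
  by split; [apply/(mem_vsetb _ ba); exists x'|apply/(mem_vsetb _ bb); exists (f x')].
- move=> x y z /mem_graph[x' /vpair_inj[-> ->]] /mem_graph[x1 /vpair_inj[]].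
  by move/a_inj => <- ->.
Qed.

Lemma star_graph_functional :
  vfunctional (M (vset (range a))) (M (vset (range b))) (M (vgraph a b f)).
Proof.
apply: star_functional graph_functional => p /mem_graph[x ->].
by exists (a x), (b (f x)).
Qed.

End graph.
End model_theory.

Section hull.
Variables (R : realType) (X : topologicalType) (S : individuals X R).
Variables (K sS : Type) (V : superstructure S) (sV : superstructure sS).
Variable M : nonstandard_model K V sV.

Definition ent_point (x : X) : V := ind (of_point S x).
Definition ent_real (r : R) : V := ind (of_real S r).
Definition ent_pair (p : R * R) : V := vpair (ent_real p.1) (ent_real p.2).

Definition star_real (r : R) : sV := M (ent_real r).
Definition star_lt (xi eta : sV) : Prop :=
  vmem (vpair xi eta) (M (vrel ent_real ent_real (fun r s => r < s))).
Definition star_abs (xi : sV) : sV :=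
  vapp (M (vgraph ent_real ent_real (fun r => `|r|))) xi.
Definition star_sub (xi eta : sV) : sV :=
  vapp (M (vgraph ent_pair ent_real (fun p => p.1 - p.2))) (vpair xi eta).

Definition star_finite (xi : sV) : Prop :=
  exists n : nat, star_lt (star_abs xi) (star_real n%:R).
Definition star_close (xi eta : sV) : Prop :=
  forall n : nat, (0 < n)%N ->
    star_lt (star_abs (star_sub xi eta)) (star_real n%:R^-1).

(* The images under [M] of a subset of X and of a function on X. *)
Definition star_set (G : set X) : sV := M (vset (ent_point @` G)).
Definition star_fun (f : X -> R) (xi : sV) : sV := vapp (M (vgraph ent_point ent_real f)) xi.

Definition star_space : Type := {xi : sV | vmem xi (star_set setT)}.

HB.instance Definition _ := gen_eqMixin star_space.
HB.instance Definition _ := gen_choiceMixin star_space.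

Definition star_open (G : set X) : set star_space :=
  [set alpha | vmem (sval alpha) (star_set G)].

Lemma ent_point_inj : injective ent_point.
Proof. by move=> x y h; exact: (of_point_inj (ind_inj h)). Qed.

Lemma mem_set_of (G : set X) x : vmem x (vset (ent_point @` G)) <-> (ent_point @` G) x.
Proof. by apply: mem_vsetb; exists 0%N => _ [s _ <-]; exists (of_point S s). Qed.

Lemma star_open_cover : \bigcup_(G in open) star_open G = setT.
Proof. by rewrite -subTset => -[x xX] _; exists setT => //; exact: openT. Qed.

Lemma star_open_join (G H : set X) (t : star_space) : open G -> open H ->
  star_open G t -> star_open H t ->
  exists L, [/\ open L, star_open L t & star_open L `<=` star_open G `&` star_open H].
Proof.
move=> oG oH tG tH; exists (G `&` H); split; first exact: openI.
  apply: star_and tG tH => x /mem_set_of[y Gy <-] /mem_set_of[z Hz /ent_point_inj zy].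
  by apply/mem_set_of; exists y => //; split=> //; rewrite -zy.
by move=> x xL; split; apply: star_subset xL => y /mem_set_of[z [Gz Hz] <-];
  apply/mem_set_of; exists z.
Qed.

HB.instance Definition _ := isBaseTopological.Build star_space
  star_open_cover star_open_join.

Definition finite_points (Phi : set (X -> R)) : set star_space :=
  [set alpha | forall f, Phi f -> star_finite (star_fun f (sval alpha))].

(* |x - y| < c, for arbitrary graphs of subtraction and absolute value, and
   its rendering as a bounded quantifier formula. *)
Definition vnear (T : Type) (W : superstructure T) (SUB ABS LT x y c : W) : Prop :=
  exists d a, [/\ vmem (vpair (vpair x y) d) SUB, vmem (vpair d a) ABS
    & vmem (vpair a c) LT].

Definition fnear x y c := BEx 20 1 (BAnd (fpair 20 x y)
  (BEx 21 0 (BEx 22 2 (BAnd (fpair 22 20 21)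
  (BEx 23 0 (BEx 24 3 (BAnd (fpair 24 21 23)
  (BEx 25 4 (fpair 25 23 c))))))))).

Lemma sat_near (T : Type) (W : superstructure T) (rho : nat -> W) x y c :
  vfunctional (rho 1) (rho 0) (rho 2) -> vfunctional (rho 0) (rho 0) (rho 3) ->
  (x < 20)%N -> (y < 20)%N -> (c < 20)%N ->
  sat rho (fnear x y c) <->
  vnear (rho 2) (rho 3) (rho 4) (rho x) (rho y) (rho c).
Proof.
move=> fS fA lx ly lc.
have l20 z n : (z < 20)%N -> (20 + n == z) = false.
  by move=> lz; apply/eqP => zn; move: lz; rewrite -zn ltnNge leq_addr.
have l100 z n : (z < 20)%N -> (z < n + 20)%N.
  by move=> lz; apply: leq_trans lz _; rewrite leq_addl.
have U z n v (r : nat -> W) : (z < 20)%N -> upd r (20 + n) v z = r z.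
  by move=> lz; apply: updN; exact: leq_trans lz (leq_addr _ _).
have [lx' ly' lc'] : [/\ x < 100, y < 100 & c < 100]%N.
  by split; [exact: (l100 x 80)|exact: (l100 y 80)|exact: (l100 c 80)].
split.
  move=> [q qRR [/sat_pair -/(_ erefl lx' ly')]].
  rewrite (U x 0) // (U y 0) // updE => qE.
  move=> [d dR [p1 p1S [/sat_pair -/(_ erefl erefl erefl) p1E]]].
  move=> [a aR [p2 p2A [/sat_pair -/(_ erefl erefl erefl) p2E]]].
  move=> [p3 p3L /sat_pair -/(_ erefl erefl lc')].
  rewrite (U c 5) // (U c 4)// (U c 3)// (U c 2)// (U c 1)// (U c 0)// => p3E.
  exists d, a; split.
  - by rewrite -qE -[vpair _ _]p1E.
  - by rewrite -[vpair _ _]p2E.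
  - by rewrite -[vpair _ _]p3E.
move=> [d [a [xyd da ac]]].
have [xyRR dR] := fun_dom fS xyd; have [_ aR] := fun_dom fA da.
exists (vpair (rho x) (rho y)) => //; split.
  by apply/sat_pair; rewrite ?(U x 0)// ?(U y 0) // updE.
exists d => //; exists (vpair (vpair (rho x) (rho y)) d) => //; split.
  exact/sat_pair.
exists a => //; exists (vpair d a) => //; split; first exact/sat_pair.
exists (vpair a (rho c)) => //; apply/sat_pair => //.
by rewrite (U c 5) // (U c 4)// (U c 3)// (U c 2)// (U c 1)// (U c 0).
Qed.

Let RE : V := vset (range ent_real).
Let RR : V := vset (range ent_pair).
Let SUB : V := vgraph ent_pair ent_real (fun p => p.1 - p.2).
Let ABS : V := vgraph ent_real ent_real (fun r => `|r|).
Let LT : V := vrel ent_real ent_real (fun r s => r < s).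

Lemma ent_real_inj : injective ent_real.
Proof. by move=> x y h; exact: (of_real_inj (ind_inj h)). Qed.

Lemma ent_pair_inj : injective ent_pair.
Proof. by move=> [x y] [x' y'] /vpair_inj[/ent_real_inj /= -> /ent_real_inj /= ->]. Qed.

Lemma bounded_real : vbounded (range ent_real).
Proof. by exists 0%N => _ [s _ <-]; exists (of_real S s). Qed.

Lemma bounded_point : vbounded (range ent_point).
Proof. by exists 0%N => _ [s _ <-]; exists (of_point S s). Qed.

Lemma bounded_pair : vbounded (range ent_pair).
Proof.
by exists 2%N => _ [p _ <-]; apply: level_pair; exact: level_ind.
Qed.

Lemma mem_LT p : vmem p LT <-> exists r s, p = vpair (ent_real r) (ent_real s) /\ r < s.
Proof.
rewrite mem_vsetb; last first.
  by exists 2%N => _ [q _ <-]; apply: level_pair; exact: level_ind.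
by split=> [[[r s] /= rs <-]|[r [s [-> rs]]]]; [exists r, s|exists (r, s)].
Qed.

Lemma functional_SUB : vfunctional RR RE SUB.
Proof. exact: (graph_functional _ ent_pair_inj bounded_pair bounded_real). Qed.

Lemma functional_ABS : vfunctional RE RE ABS.
Proof. exact: (graph_functional _ ent_real_inj bounded_real bounded_real). Qed.

Lemma star_functional_SUB : vfunctional (M RR) (M RE) (M SUB).
Proof. exact: (star_graph_functional _ _ ent_pair_inj bounded_pair bounded_real). Qed.

Lemma star_functional_ABS : vfunctional (M RE) (M RE) (M ABS).
Proof. exact: (star_graph_functional _ _ ent_real_inj bounded_real bounded_real). Qed.

Lemma near_real r s t :
  vnear SUB ABS LT (ent_real r) (ent_real s) (ent_real t) <-> `|r - s| < t.
Proof.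
pose hS := mem_graph (fun p => p.1 - p.2) bounded_pair bounded_real.
pose hA := mem_graph (fun r : R => `|r|) bounded_real bounded_real.
split=> [[d [a [/hS[[r1 s1] /vpair_inj[]]]]]|rst].
  move=> /(@ent_pair_inj (r, s)) [<- <-] ->.
  move=> /hA[u /vpair_inj[/ent_real_inj <- ->]].
  by move=> /mem_LT[v [w [/vpair_inj[/ent_real_inj <- /ent_real_inj <-]]]].
exists (ent_real (r - s)), (ent_real `|r - s|); split.
- by apply/hS; exists (r, s).
- by apply/hA; exists (r - s).
- by apply/mem_LT; exists `|r - s|, t.
Qed.

Lemma star_mem_pair xi eta : vmem xi (M RE) -> vmem eta (M RE) ->
  vmem (vpair xi eta) (M RR).
Proof.
have h := proj1 (star_transfer M (BAll 2 0 (BAll 3 0 (BEx 4 1 (fpair 4 2 3))))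
  (nth RE [:: RE; RR])).
move=> xiR etaR; have [|p pRR /sat_pair -/(_ erefl erefl erefl) pE] := h _ xi xiR eta etaR.
  move=> x /mem_vsetb -/(_ bounded_real)[r _ <-].
  move=> y /mem_vsetb -/(_ bounded_real)[s _ <-].
  exists (ent_pair (r, s)); last exact/sat_pair.
  by apply/mem_vsetb; [exact: bounded_pair|exists (r, s)].
by rewrite -[vpair _ _]pE.
Qed.

Lemma star_near xi eta c : vmem xi (M RE) -> vmem eta (M RE) ->
  vnear (M SUB) (M ABS) (M LT) xi eta c <-> 
  star_lt (star_abs (star_sub xi eta)) c.
Proof.
move=> xiR etaR; have xeR := star_mem_pair xiR etaR.
have [dR dP] := functional_app star_functional_SUB xeR.
have [aR aP] := functional_app star_functional_ABS dR.
split=> [[d [a [/dP -> /aP ->]]]//|ac].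
by eexists; eexists; split; [exact/dP|exact/aP|exact: ac].
Qed.

Let near_sat x y c (c1 c2 : R) : (x < 20)%N -> (y < 20)%N -> (c < 20)%N ->
  forall v1 v2 v3, 
  let rho := nth RE [:: RE; RR; SUB; ABS; LT; ent_real c1; ent_real c2] in
  let rho' := upd (upd (upd rho 7 v1) 8 v2) 9 v3 in
  sat rho' (fnear x y c) <-> vnear SUB ABS LT (rho' x) (rho' y) (rho' c).
Proof.
move=> lx ly lc v1 v2 v3 rho rho'.
by apply: sat_near => //; [exact: functional_SUB|exact: functional_ABS].
Qed.

Let near_star_sat x y c (c1 c2 : R) : (x < 20)%N -> (y < 20)%N -> (c < 20)%N ->
  forall v1 v2 v3, 
  let rho := M \o nth RE [:: RE; RR; SUB; ABS; LT; ent_real c1; ent_real c2] in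
  let rho' := upd (upd (upd rho 7 v1) 8 v2) 9 v3 in
  sat rho' (fnear x y c) <-> vnear (M SUB) (M ABS) (M LT) (rho' x) (rho' y) (rho' c).
Proof.
move=> lx ly lc v1 v2 v3 rho rho'.
by apply: sat_near => //; [exact: star_functional_SUB|exact: star_functional_ABS].
Qed.

Lemma star_near_tri c1 c2 xi eta zeta :
  vmem xi (M RE) -> vmem eta (M RE) -> vmem zeta (M RE) ->
  c1 + c1 <= c2 ->
  vnear (M SUB) (M ABS) (M LT) xi eta (star_real c1) ->
  vnear (M SUB) (M ABS) (M LT) zeta eta (star_real c1) ->
  vnear (M SUB) (M ABS) (M LT) xi zeta (star_real c2).
Proof.
move=> xR yR zR c12 xy zy.
pose rho := nth RE [:: RE; RR; SUB; ABS; LT; ent_real c1; ent_real c2].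
have h := proj1 (star_transfer M (BAll 7 0 (BAll 8 0 (BAll 9 0
  (BImp (fnear 7 8 5) (BImp (fnear 9 8 5) (fnear 7 9 6)))))) rho).
apply/(@near_star_sat 7 9 6 c1 c2 erefl erefl erefl xi eta zeta).
apply: h => //; last 2 first.
- exact/(@near_star_sat 7 8 5 c1 c2 erefl erefl erefl xi eta zeta).
- exact/(@near_star_sat 9 8 5 c1 c2 erefl erefl erefl xi eta zeta).
move=> x /mem_vsetb -/(_ bounded_real)[r _ <-].
move=> y /mem_vsetb -/(_ bounded_real)[s _ <-].
move=> z /mem_vsetb -/(_ bounded_real)[t _ <-].
move=> /(@near_sat 7 8 5 c1 c2 erefl erefl erefl) /near_real rs.
move=> /(@near_sat 9 8 5 c1 c2 erefl erefl erefl) /near_real ts.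
apply/(@near_sat 7 9 6 c1 c2 erefl erefl erefl); apply/near_real.
rewrite -(subrKA s) (le_lt_trans (ler_normD _ _))// (lt_le_trans _ c12)//.
by rewrite ltrD// distrC.
Qed.

Lemma star_near_refl c xi : 0 < c -> vmem xi (M RE) ->
  vnear (M SUB) (M ABS) (M LT) xi xi (star_real c).
Proof.
move=> c0 xR; pose rho := nth RE [:: RE; RR; SUB; ABS; LT; ent_real c; ent_real c].
have h := proj1 (star_transfer M (BAll 7 0 (BAll 8 0 (BAll 9 0 (fnear 7 7 5)))) rho).
apply/(@near_star_sat 7 7 5 c c erefl erefl erefl xi xi xi).
apply: h => //.
move=> x /mem_vsetb -/(_ bounded_real)[r _ <-] y _ z _.
by apply/(@near_sat 7 7 5 c c erefl erefl erefl); apply/near_real; rewrite subrr normr0.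
Qed.

Lemma star_close_refl xi : vmem xi (M RE) -> star_close xi xi.
Proof.
move=> xR n n0; apply/star_near => //; apply: star_near_refl => //.
by rewrite invr_gt0 ltr0n.
Qed.

Lemma star_close_tri xi eta zeta :
  vmem xi (M RE) -> vmem eta (M RE) -> vmem zeta (M RE) ->
  star_close xi eta -> star_close zeta eta -> star_close xi zeta.
Proof.
move=> xR yR zR xy zy n n0.
apply/star_near => //; apply: (@star_near_tri (n + n)%:R^-1 _ _ eta) => //.
- by rewrite addnn -mul2n natrM invfM -mulrDl -[2^-1]mul1r -splitr mul1r.
- by apply/star_near => //; apply: xy; rewrite addn_gt0 n0.
- by apply/star_near => //; apply: zy; rewrite addn_gt0 n0.
Qed.

Lemma star_fun_real f xi : vmem xi (star_set setT) -> vmem (star_fun f xi) (M RE).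
Proof.
have H := star_graph_functional M f ent_point_inj bounded_point bounded_real.
move=> h; exact: (functional_app H h).1.
Qed.

Definition hull_rel (Phi : set (X -> R)) : rel (finite_points Phi) :=
  fun alpha beta => `[< forall f, Phi f ->
    star_close (star_fun f (sval (val alpha))) (star_fun f (sval (val beta))) >].

Lemma hull_rel_equiv Phi : equiv_class_of (@hull_rel Phi).
Proof.
have Rf f (a : finite_points Phi) : vmem (star_fun f (sval (val a))) (M RE).
  exact: star_fun_real (svalP (val a)).
have refl : reflexive (@hull_rel Phi).
  by move=> a; apply/asboolP => f _; exact: star_close_refl.
have euc a b c : hull_rel a b -> hull_rel c b -> @hull_rel Phi a c.
  move=> /asboolP ab /asboolP cb; apply/asboolP => f Pf.
  exact: star_close_tri (ab _ Pf) (cb _ Pf).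
have sym a b : hull_rel a b -> @hull_rel Phi b a by apply: euc; exact: refl.
split=> // [a b|b a c ab bc]; first by apply/idP/idP; exact: sym.
exact: euc ab (sym _ _ bc).
Qed.

Canonical hull_equiv Phi := EquivRelPack (hull_rel_equiv Phi).

Definition hull (Phi : set (X -> R)) : topologicalType :=
  quotient_topology {eq_quot (hull_equiv Phi)}%qT.

End hull.

(* Main.v *)
Require Import Defs.
From mathcomp Require Import all_boot all_order all_algebra.
From mathcomp Require Import generic_quotient.
From mathcomp Require Import all_classical all_reals all_analysis.
From mathcomp Require Import lra.

Import Order.TTheory GRing.Theory Num.Theory.
Import numFieldNormedType.Exports.

Local Open Scope classical_set_scope.

(* A finite hyperreal has a standard part, so each f in Phi induces a map
   alpha |-> st( *f alpha) on the finite points. If st( *f alpha) = a, then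
   alpha belongs to the basic open set *(f^-1 (a - e, a + e)) for all e > 0;
   hence the induced map is continuous. It is compatible with the equivalence
   and so descends to the hull, and the induced maps separate the points of the
   hull because hyperreals with the same standard part are infinitely close. *)

(** Disjoint open neighbourhoods of [g x] and [g y] pull back along [g]. *)
Lemma hausdorff_separated_by_continuous (T U : topologicalType) :
  hausdorff_space U ->
  (forall x y : T, x != y -> exists2 g : T -> U, continuous g & g x != g y) ->
  hausdorff_space T.
Proof.
rewrite !open_hausdorff => hU sep x y /sep[g /continuousP cg /hU].
move=> [[A B] /= [Ax By] [oA oB AB0]].
exists (g @^-1` A, g @^-1` B) => /=.
  by move: Ax By; rewrite !inE.
split; [exact: cg|exact: cg|].
by rewrite -preimage_setI (eqP AB0) preimage_set0.
Qed.

Local Open Scope ring_scope.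

(** * Transfer of emptiness and of covers by two sets *)

Section star_sets.
Context {K S sS : Type} {V : superstructure S} {sV : superstructure sS}.
Variable M : nonstandard_model K V sV.

(** Emptiness is transferred as the bounded formula saying that each member differs from itself. *)
Lemma star_empty (A : V) : (forall x, ~ vmem x A) -> forall x, ~ vmem x (M A).
Proof.
move=> A0 x xA; apply: (proj1 (star_transfer M
  (BAll 1 0 (BNot (BEq 1 1))) (nth A [:: A])) _ x xA erefl).
by move=> y /A0.
Qed.

Lemma star_or (A B C : V) : (forall x, vmem x A -> vmem x B \/ vmem x C) ->
  forall x, vmem x (M A) -> vmem x (M B) \/ vmem x (M C).
Proof.
move=> ABC; apply: (proj1 (star_transfer M
  (BAll 3 0 (BOr (BMem 3 1) (BMem 3 2))) (nth A [:: A; B; C]))).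
exact: ABC.
Qed.

End star_sets.

(** * Extensions of sets of reals, and standard parts of finite hyperreals *)

Section standard_part.
Context {R : realType} {X : topologicalType} {S : individuals X R}.
Context {K sS : Type} {V : superstructure S} {sV : superstructure sS}.
Variable M : nonstandard_model K V sV.

Local Notation ent_real := (ent_real (S := S) V).
Let RE : V := vset (range ent_real).
Let RR : V := vset (range (ent_pair (S := S) V)).
Let SUB : V := vgraph (ent_pair (S := S) V) ent_real (fun p => p.1 - p.2).
Let ABS : V := vgraph ent_real ent_real (fun r => `|r|).
Let LT : V := vrel ent_real ent_real (fun r s => r < s).

Definition ent_reals (P : set R) : V := vset (ent_real @` P).
Definition ent_points (G : set X) : V := vset (ent_point V @` G).

Lemma mem_reals P x : vmem x (ent_reals P) <-> (ent_real @` P) x.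
Proof. by apply: mem_vsetb; exists 0%N => _ [s _ <-]; exists (of_real S s). Qed.

Lemma mem_ent_real P r : vmem (ent_real r) (ent_reals P) <-> P r.
Proof.
rewrite mem_reals; split=> [[s Ps /ent_real_inj <- //]|Pr].
by exists r.
Qed.

Lemma mem_ent_point G x : vmem (ent_point V x) (ent_points G) <-> G x.
Proof.
rewrite mem_set_of; split=> [[y Gy /ent_point_inj <- //]|Gx].
by exists x.
Qed.

Lemma star_reals_subset (P Q : set R) xi : P `<=` Q ->
  vmem xi (M (ent_reals P)) -> vmem xi (M (ent_reals Q)).
Proof.
move=> PQ; apply: star_subset => _ /mem_reals[r Pr <-].
by apply/mem_ent_real; exact: PQ.
Qed.

Lemma star_realsI (P Q : set R) xi :
  vmem xi (M (ent_reals P)) -> vmem xi (M (ent_reals Q)) -> vmem xi (M (ent_reals (P `&` Q))).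
Proof.
apply: star_and => _ /mem_reals[r Pr <-] /mem_ent_real Qr.
by apply/mem_ent_real.
Qed.

Lemma star_realsC (P : set R) xi : vmem xi (M (ent_reals setT)) ->
  vmem xi (M (ent_reals P)) \/ vmem xi (M (ent_reals (~` P))).
Proof.
apply: star_or => _ /mem_reals[r _ <-]; rewrite !mem_ent_real.
exact: EM.
Qed.

(** This brings inequalities on hyperreals back to the reals: a common member [xi] of the extensions
    forces a genuine real in both sets, because the extension of the empty set is empty. *)
Lemma star_reals_meet {P Q : set R} {xi} : vmem xi (M (ent_reals P)) ->
  vmem xi (M (ent_reals Q)) -> P `&` Q !=set0.
Proof.
move=> xP xQ; have xPQ := star_realsI _ _ _ xP xQ.
apply/set0P/eqP => PQ0; apply: star_empty xPQ => x /mem_reals[r].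
by rewrite PQ0.
Qed.

(** Ties the basic open sets of [star_space] to the values of [star_fun]. Each direction transfers a
    fact about the pairs in the graph of [f]. *)
Lemma star_fun_preimage (f : X -> R) (P : set R) xi :
  vmem xi (star_set M setT) ->
  vmem xi (M (ent_points (f @^-1` P))) <-> vmem (star_fun M f xi) (M (ent_reals P)).
Proof.
move=> xX; pose F := vgraph (ent_point V) ent_real f.
have memF := mem_graph f (bounded_point V) (bounded_real V).
have sfR := star_fun_real f xX.
have H := star_graph_functional M f (@ent_point_inj _ _ _ V)
  (bounded_point V) (bounded_real V).
have xF : vmem (vpair xi (star_fun M f xi)) (M F).
  by apply/(functional_app H xX).2.
pose rho := nth RE [:: RE; ent_points setT; F; ent_points (f @^-1` P); ent_reals P].
split=> [xA|fP].
- have h := proj1 (star_transfer M (BAll 5 3 (BAll 6 0 (BAll 7 2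
    (BImp (fpair 7 5 6) (BMem 6 4))))) rho).
  apply: (h _ xi xA _ sfR _ xF); last exact/sat_pair.
  move=> _ /mem_set_of[x Px <-] u _ p pF /sat_pair -/(_ erefl erefl erefl) /= pE.
  have [y] := (memF p).1 pF.
  rewrite [p]pE => /vpair_inj[/ent_point_inj <- uE].
  by rewrite /upd/= [u]uE; apply/mem_ent_real.
- have h := proj1 (star_transfer M (BAll 5 4 (BAll 6 1 (BAll 7 2
    (BImp (fpair 7 6 5) (BMem 6 3))))) rho).
  apply: (h _ _ fP xi xX _ xF); last exact/sat_pair.
  move=> _ /mem_reals[r Pr <-] x _ p pF /sat_pair -/(_ erefl erefl erefl) /= pE.
  have [y] := (memF p).1 pF.
  rewrite [p]pE => /vpair_inj[xE /ent_real_inj rE].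
  by rewrite /upd/= [x]xE; apply/mem_ent_point; rewrite /= -rE.
Qed.

Lemma star_finite_bounded xi : vmem xi (M RE) -> star_finite M xi ->
  exists n : nat, vmem xi (M (ent_reals [set r | `|r| < n%:R])).
Proof.
move=> xR [n lt_n]; exists n.
have [aR aP] := functional_app (star_functional_ABS M) xR.
pose B := ent_reals [set r | `|r| < n%:R].
pose rho := nth RE [:: RE; ABS; LT; ent_real n%:R; B].
(* Variables 5 to 8 stand for a real, its absolute value, and the pairs lying in [ABS] and [LT]; 3
   is the bound [n] and 4 the set [B]. *)
have h := proj1 (star_transfer M (BAll 5 0 (BAll 6 0 (BAll 7 1 (BAll 8 2
  (BImp (fpair 7 5 6) (BImp (fpair 8 6 3) (BMem 5 4))))))) rho).
apply: (h _ xi xR _ aR _ ((aP _).2 erefl) _ lt_n); try exact/sat_pair.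
move=> _ /mem_vsetb -/(_ (bounded_real V))[r _ <-] u _ p pA q qL.
move=> /sat_pair -/(_ erefl erefl erefl) /= pE.
move=> /sat_pair -/(_ erefl erefl erefl) /= qE.
have [s] := (mem_graph _ (bounded_real V) (bounded_real V) _).1 pA.
rewrite [p]pE => /vpair_inj[/ent_real_inj rs uE].
have [t [w []]] := (mem_LT _).1 qL.
rewrite [q]qE [upd _ _ _ _]uE => /vpair_inj[/ent_real_inj st /ent_real_inj nw] tw.
by apply/mem_ent_real; rewrite /= rs st nw.
Qed.

(** The first five constants are in the positions that [fnear] expects; 5 holds the bound [c], and 8
    and 9 are the two points compared. *)
Lemma sat_near_reals (P Q : set R) (c : R) x y :
  let rho := nth RE [:: RE; RR; SUB; ABS; LT; ent_real c; ent_reals P; ent_reals Q] in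
  sat (upd (upd rho 8 x) 9 y) (fnear 8 9 5) <->
    vnear SUB ABS LT x y (ent_real c).
Proof.
by apply: sat_near => //; [exact: functional_SUB|exact: functional_ABS].
Qed.

Lemma star_sat_near_reals (P Q : set R) (c : R) x y :
  let rho := M \o nth RE
    [:: RE; RR; SUB; ABS; LT; ent_real c; ent_reals P; ent_reals Q] in
  sat (upd (upd rho 8 x) 9 y) (fnear 8 9 5) <->
    vnear (M SUB) (M ABS) (M LT) x y (star_real M c).
Proof.
by apply: sat_near => //; [exact: star_functional_SUB|exact: star_functional_ABS].
Qed.

Lemma star_reals_near (P Q : set R) (c : R) xi eta :
  (forall r s, P r -> Q s -> `|r - s| < c) ->
  vmem xi (M (ent_reals P)) -> vmem eta (M (ent_reals Q)) ->
  vnear (M SUB) (M ABS) (M LT) xi eta (star_real M c).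
Proof.
move=> PQ xP yQ.
have h := proj1 (star_transfer M (BAll 8 6 (BAll 9 7 (fnear 8 9 5)))
  (nth RE [:: RE; RR; SUB; ABS; LT; ent_real c; ent_reals P; ent_reals Q])).
apply/(star_sat_near_reals P Q); apply: h => //.
move=> _ /mem_reals[r Pr <-] _ /mem_reals[s Qs <-].
by apply/sat_near_reals/near_real; exact: PQ.
Qed.

(** Applied to balls [P] and [Q] about a common centre, this moves a standard part from [xi] to
    [eta]. *)
Lemma near_star_reals (P Q : set R) (c : R) xi eta :
  (forall r s, P r -> `|r - s| < c -> Q s) ->
  vmem xi (M (ent_reals P)) -> vmem eta (M RE) ->
  vnear (M SUB) (M ABS) (M LT) xi eta (star_real M c) ->
  vmem eta (M (ent_reals Q)).
Proof.
move=> PQ xP yR xy.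
have h := proj1 (star_transfer M (BAll 8 6 (BAll 9 0
    (BImp (fnear 8 9 5) (BMem 9 7))))
  (nth RE [:: RE; RR; SUB; ABS; LT; ent_real c; ent_reals P; ent_reals Q])).
apply: (h _ xi xP eta yR); last exact/(star_sat_near_reals P Q).
move=> _ /mem_reals[r Pr <-] _ /mem_reals[s _ <-].
move/sat_near_reals/near_real => rs.
by apply/mem_ent_real; exact: PQ rs.
Qed.

(** Closeness to a real is phrased by extended balls rather than by [star_close], so that Boolean
    operations on sets of reals apply. *)
Definition has_standard_part (xi : sV) (a : R) :=
  forall e, 0 < e -> vmem xi (M (ent_reals [set r | `|r - a| < e])).

Lemma standard_part_unique {xi a b} :
  has_standard_part xi a -> has_standard_part xi b -> a = b.
Proof.
move=> xa xb; apply/eqP; rewrite -subr_eq0 -normr_le0 leNgt; apply/negP => ab0.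
(* The balls of this radius about [a] and [b] are disjoint, yet [xi] lies in both extensions. *)
have e0 : 0 < `|a - b| / 2 by rewrite divr_gt0.
have [r [/= ra rb]] := star_reals_meet (xa _ e0) (xb _ e0).
suff : `|a - b| < `|a - b| by rewrite ltxx.
rewrite -{1}(subrKA r) (le_lt_trans (ler_normD _ _))// [ltRHS]splitr.
by rewrite ltrD// distrC.
Qed.

Lemma standard_part_close {xi eta a} : vmem xi (M RE) -> vmem eta (M RE) ->
  has_standard_part xi a -> has_standard_part eta a -> star_close M xi eta.
Proof.
move=> xR yR xa ya n n0; apply/star_near => //.
have e0 : 0 < n%:R^-1 / 2 :> R by rewrite divr_gt0// invr_gt0 ltr0n.
apply: star_reals_near (xa _ e0) (ya _ e0) => r s /= ra sa.
rewrite -(subrKA a) (le_lt_trans (ler_normD _ _))// [ltRHS]splitr.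
by rewrite ltrD// distrC.
Qed.

Lemma close_standard_part {xi eta a} : vmem xi (M RE) -> vmem eta (M RE) ->
  star_close M xi eta -> has_standard_part xi a -> has_standard_part eta a.
Proof.
move=> xR yR xy xa e e0; have e20 : 0 < e / 2 by rewrite divr_gt0.
(* [star_close] speaks of reciprocals of naturals only, so the Archimedean property picks one below
   [e / 2]. *)
have [n] := @ltr_add_invr R 0 (e / 2) e20; rewrite add0r => ne.
have /star_near -/(_ xR yR) := xy n.+1 (ltn0Sn _).
apply: near_star_reals (xa _ e20) yR => r s /= ra rs.
rewrite -(subrKA r) (le_lt_trans (ler_normD _ _))// [ltRHS]splitr.
by rewrite ltrD// distrC (lt_trans rs).
Qed.

(** The standard part is the supremum of the reals below [xi]; finiteness makes this set nonempty
    and bounded above. *)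
Lemma standard_part_exists xi : vmem xi (M RE) -> star_finite M xi ->
  exists a, has_standard_part xi a.
Proof.
move=> xR /(star_finite_bounded _ xR)[n xn].
pose A := [set q | vmem xi (M (ent_reals [set r | q < r]))].
have Aub : ubound A n%:R.
  move=> q xq; have [r [/= rn qr]] := star_reals_meet xn xq.
  by rewrite (le_trans (ltW qr))// (le_trans (ler_norm _))// ltW.
have A0 : A (- n%:R).
  by apply: star_reals_subset xn => r /=; rewrite ltr_norml => /andP[].
have hA : has_sup A by split; [exists (- n%:R)|exists n%:R].
exists (sup A) => e e0.
have [q Aq lt_q] := sup_adherent e0 hA.
have ubA : ~ A (sup A + e / 2).
  by move=> /(ub_le_sup hA.2); rewrite gerDl leNgt divr_gt0.
(* As [xi] is not above [sup A + e / 2], it lies in the extension of the complement, while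
   [q > sup A - e] bounds it from below. *)
have [//|] := star_realsC [set r | sup A + e / 2 < r] xi xR.
move=> xle; apply: star_reals_subset (star_realsI _ _ _ Aq xle) => r [/=].
move=> qr /negP; rewrite -leNgt => re.
by rewrite ltr_norml; apply/andP; split; lra.
Qed.

Section finite_points.
Variables (Phi : set (X -> R)) (f : X -> R).
Hypotheses (Pf : Phi f) (cf : continuous f).

Definition standard_part (alpha : finite_points (M := M) Phi) : R :=
  xget 0 (has_standard_part (star_fun M f (sval (val alpha)))).

Lemma star_fun_finite_points (alpha : finite_points (M := M) Phi) :
  vmem (star_fun M f (sval (val alpha))) (M RE).
Proof. exact: star_fun_real (svalP (val alpha)). Qed.

Lemma standard_partP alpha :
  has_standard_part (star_fun M f (sval (val alpha))) (standard_part alpha).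
Proof.
apply: xgetPex; apply: standard_part_exists (star_fun_finite_points _) _.
by case: alpha => a /= /set_mem; exact.
Qed.

(** If [beta] lies in the extended preimage of the ball of radius [e / 2] about the standard part at
    [alpha], some real is within [e / 2] of both standard parts. *)
Lemma standard_part_continuous : continuous standard_part.
Proof.
move=> alpha U /nbhs_ballP[e /= e0 eU].
have e20 : 0 < e / 2 by rewrite divr_gt0.
pose B := [set r | `|r - standard_part alpha| < e / 2].
have inB (beta : finite_points (M := M) Phi) :
    star_open (M := M) (f @^-1` B) (val beta) <->
    vmem (star_fun M f (sval (val beta))) (M (ent_reals B)).
  exact: star_fun_preimage (svalP (val beta)).
have oG : open (f @^-1` B).
  apply: open_comp => [x _|]; first exact: cf.
  rewrite (_ : B = ball (standard_part alpha) (e / 2)); first exact: ball_open.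
  by apply/seteqP; split=> r; rewrite /B /ball/= distrC.
have oB : open (star_open (M := M) (f @^-1` B)).
  exists [set f @^-1` B]; first by move=> _ ->.
  by rewrite bigcup_set1.
(* The topology on the finite points is initial for [val], so the basic open set restricts to a
   neighbourhood. *)
have nbB : nbhs alpha (val @^-1` star_open (M := M) (f @^-1` B)).
  apply: (@initial_continuous (finite_points (M := M) Phi) _ val).
  by apply: open_nbhs_nbhs; split=> //; apply/inB; exact: standard_partP.
have nF := @nbhs_filter (finite_points (M := M) Phi) alpha.
apply: (@filterS _ _ nF _ _ _ nbB) => beta bB; apply: eU.
have [r [/= ra rb]] := star_reals_meet ((inB _).1 bB) (standard_partP beta _ e20).
rewrite /ball/= -(subrKA r) (le_lt_trans (ler_normD _ _))// [ltRHS]splitr.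
by rewrite ltrD// distrC.
Qed.

End finite_points.
End standard_part.

(** * Separation of the points of the hull *)

Lemma eq_hullP {R : realType} {X : topologicalType} {S : individuals X R}
    {V : superstructure S} {sS K : Type} {sV : superstructure sS}
    (M : nonstandard_model K V sV) (Phi : set (X -> R))
    (alpha beta : finite_points (M := M) Phi) :
  \pi_(hull M Phi)%qT alpha = \pi_(hull M Phi)%qT beta <->
  forall f, Phi f ->
    star_close M (star_fun M f (sval (val alpha))) (star_fun M f (sval (val beta))).
Proof.
have H := @eqmodP _ (hull_equiv M Phi) alpha beta.
by split=> [/H/asboolP|?]; last exact/H/asboolP.
Qed.

Theorem mainTheorem3 (R : realType) (X : topologicalType)
    (S : individuals X R) (V : superstructure S)
    (sS : Type) (sV : superstructure sS)
    (K : Type) (K_infinite : infinite_set [set: K])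
    (K_large : card_lt [set G : set X | open G] [set: K])
    (M : nonstandard_model K V sV)
    (Phi : set (X -> R)) (Phi_continuous : Phi `<=` [set f | continuous f]) :
  hausdorff_space (hull M Phi).
Proof.
apply: (@hausdorff_separated_by_continuous _ R (@Rhausdorff R)) => x y.
move=> xy; pose a := repr x; pose b := repr y.
(* Otherwise the chosen representatives would be equivalent, and [x] would equal [y]. *)
have [f [Pf nab]] : exists f, Phi f /\
    ~ star_close M (star_fun M f (sval (val a))) (star_fun M f (sval (val b))).
  apply: contrapT => nf; case/negP: xy; apply/eqP.
  rewrite -(reprK x) -(reprK y).
  apply/eq_hullP => f Pf.
  by apply: contrapT => nab; apply: nf; exists f.
have realF c : vmem (star_fun M f (sval (val c))) _ :=
  star_fun_finite_points M Phi f c.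
have stP := standard_partP M Phi f Pf.
(* This map on the hull is continuous because [standard_part] takes equal values on equivalent
   points. *)
exists (standard_part M Phi f \o repr).
  apply: repr_comp_continuous.
    exact: standard_part_continuous Pf (Phi_continuous _ Pf).
  move=> c d /eqP/eq_hullP/(_ _ Pf) cd; apply/eqP.
  exact: standard_part_unique (close_standard_part M (realF c) (realF d) cd (stP c)) (stP d).
apply/eqP => /= stab; apply: nab.
apply: (standard_part_close M (realF a) (realF b) (stP a)).
by rewrite [standard_part _ _ _ _]stab; exact: stP.
Qed.
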